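(* Let $\dot x=P(x,y),\ \dot y=Q(x,y)$ be a real planar polynomial differential system of degree $2$ (that is, $\max\{\deg P,\deg Q\}=2$), with $P\not\equiv 0$, $Q\not\equiv 0$ and $P,Q$ without non-constant common factor, which is quasi-homogeneous but non-homogeneous. Then, when restricted to at least one of the half-planes $\{y>0\}$ or $\{x>0\}$, the system can be transformed to one of the following two homogeneous systems (with real coefficients): $\mathcal{H}_1$: $\dot x=c_{01}y+c_{10}x,\ \ \dot y=d_{01}y+d_{10}x$, where either $c_{01}d_{10}\neq 0$; or $d_{10}=0$ and $c_{01}c_{10}d_{01}\neq 0$; or $c_{01}=0$ and $c_{10}d_{01}d_{10}\neq 0$; $\mathcal{H}_0$: $\dot x=c_0,\ \ \dot y=d_0$, where $c_0d_0\neq 0$.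
   Context: Let $\mathbb{N}$ denote the positive integers and $\mathbb{R}_+$ the positive reals. The system $\dot x=P,\ \dot y=Q$ is quasi-homogeneous if there exist $s_1,s_2,d\in\mathbb{N}$ such that for every $\alpha\in\mathbb{R}_+$ $$P(\alpha^{s_1}x,\alpha^{s_2}y)=\alpha^{s_1+d-1}P(x,y),\qquad Q(\alpha^{s_1}x,\alpha^{s_2}y)=\alpha^{s_2+d-1}Q(x,y).$$ Then $(s_1,s_2,d)$ is called a weight vector. A weight vector $(\tilde s_1,\tilde s_2,\tilde d)$ is minimal if every other weight vector $(s_1,s_2,d)$ of the system satisfies $\tilde s_1\le s_1$, $\tilde s_2\le s_2$, $\tilde d\le d$. The system is homogeneous (of degree $d$) when it admits a weight vector with $s_1=s_2=1$, and non-homogeneous otherwise. ''Can be transformed'' means the following. After possibly a re-scaling of the variables ($x$, $y$ and $t$ each multiplied by a nonzero real constant), let $(s_1,s_2,d)$ be the minimal weight vector and perform on the half-plane the change of variables $\tilde x=x^{s_2},\ \tilde y=y^{s_1}$, followed by a re-scaling of time by a monomial. That is, there are integers $k,l\ge 0$ such that on the half-plane $$\frac{d\tilde x}{dt}=x^ky^l\,\tilde P(\tilde x,\tilde y),\qquad \frac{d\tilde y}{dt}=x^ky^l\,\tilde Q(\tilde x,\tilde y),$$ where $\tilde P,\tilde Q$ are the right-hand sides of the homogeneous system (whose variables are again written $x,y$). *)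

(* Defs.v *)
From HB Require Import structures.
From mathcomp Require Import all_boot all_order all_algebra.
From mathcomp Require Import classical_sets functions reals.
From mathcomp Require Import mpoly.

Set Implicit Arguments.
Unset Strict Implicit.
Unset Printing Implicit Defensive.

Import Order.TTheory GRing.Theory Num.Theory.

Local Open Scope classical_set_scope.
Local Open Scope ring_scope.

Section PlanarSystems.
Variable R : realType.
Implicit Types (P Q f : {mpoly R[2]}) (H : set (R * R)).

Definition varx : {mpoly R[2]} := 'X_(@ord0 1).
Definition vary : {mpoly R[2]} := 'X_(@ord_max 1).

Definition peval P (x y : R) : R := P.@[fun i => if i == ord0 then x else y].

Definition no_common_factor P Q : Prop :=
  forall D A B : {mpoly R[2]}, P = D * A -> Q = D * B -> exists c : R, D = c%:MP.

(* Since d > 0, the truncated subtraction in the exponents is exact. *)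
Definition weight_vector P Q (s1 s2 d : nat) : Prop :=
  [/\ (0 < s1)%N, (0 < s2)%N, (0 < d)%N &
      forall alpha x y : R, 0 < alpha ->
        peval P (alpha ^+ s1 * x) (alpha ^+ s2 * y)
          = alpha ^+ (s1 + d - 1) * peval P x y /\
        peval Q (alpha ^+ s1 * x) (alpha ^+ s2 * y)
          = alpha ^+ (s2 + d - 1) * peval Q x y].

Definition minimal_weight_vector P Q (s1 s2 d : nat) : Prop :=
  weight_vector P Q s1 s2 d /\
  forall r1 r2 e : nat, weight_vector P Q r1 r2 e ->
    [/\ (s1 <= r1)%N, (s2 <= r2)%N & (d <= e)%N].

Definition quasi_homogeneous P Q : Prop :=
  exists s1 s2 d : nat, weight_vector P Q s1 s2 d.

Definition homogeneous P Q : Prop := exists d : nat, weight_vector P Q 1 1 d.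

(* With X = a x, Y = b y and T = c t, the system x' = P, y' = Q becomes
   dX/dT = (a / c) P(X / a, Y / b), dY/dT = (b / c) Q(X / a, Y / b). *)
Definition rescale_poly (a b : R) P : {mpoly R[2]} :=
  P \mPo [tuple a^-1 *: varx; b^-1 *: vary].
Definition rescaleP (a b c : R) P := (a / c) *: rescale_poly a b P.
Definition rescaleQ (a b c : R) Q := (b / c) *: rescale_poly a b Q.

(* df/dt along the solutions of x' = P, y' = Q. *)
Definition time_derivative P Q f : {mpoly R[2]} :=
  f^`M(ord0) * P + f^`M(ord_max) * Q.

Definition upper_halfplane : set (R * R) := [set p | 0 < p.2].
Definition right_halfplane : set (R * R) := [set p | 0 < p.1].

(* The half-plane H is that of the re-scaled variables. Being a change of
   variables on H means that (x, y) |-> (x ^+ s2, y ^+ s1) is a bijection of H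
   onto itself; this is what makes the choice of the half-plane matter, as s1
   must be odd on {x > 0} and s2 must be odd on {y > 0}. *)
Definition transformable H P Q Pt Qt : Prop :=
  exists a b c : R, [/\ a != 0, b != 0, c != 0 &
  let P' := rescaleP a b c P in
  let Q' := rescaleQ a b c Q in
  exists s1 s2 d : nat, [/\ minimal_weight_vector P' Q' s1 s2 d,
    set_bij H H (fun p : R * R => (p.1 ^+ s2, p.2 ^+ s1)) &
    exists k l : nat, forall x y : R, H (x, y) ->
      peval (time_derivative P' Q' (varx ^+ s2)) x y
        = x ^+ k * y ^+ l * peval Pt (x ^+ s2) (y ^+ s1) /\
      peval (time_derivative P' Q' (vary ^+ s1)) x y
        = x ^+ k * y ^+ l * peval Qt (x ^+ s2) (y ^+ s1)]].

End PlanarSystems.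

Arguments varx {R}.
Arguments vary {R}.

(* Main.v *)
Require Import Defs.
From mathcomp Require Import all_boot all_order all_algebra.
From mathcomp Require Import classical_sets functions reals.
From mathcomp Require Import mpoly zify ring lra.

(* Evaluating the weight identities at alpha = 2 shows that every monomial
   x^i y^j of P lies on the line s1 i + s2 j = s1 + d - 1, and every one of Q on
   the parallel line s1 i + s2 j = s2 + d - 1. If s1 = s2 the system is
   homogeneous; if s1 > s2, comparing these lines with the six monomials of
   degree at most 2, and excluding the common factors x and y, leaves only
     x' = a x + b y^2, y' = c y           with minimal weights (2, 1, 1),
     x' = a x y,       y' = b x + c y^2   with minimal weights (2, 1, 2),
     x' = a y^2,       y' = b x           with minimal weights (3, 2, 2),
   with nonzero coefficients; s1 < s2 is symmetric under x <-> y. In each case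
   the change of variables is carried out directly, without re-scaling. *)

Set Implicit Arguments.
Unset Strict Implicit.
Unset Printing Implicit Defensive.

Import Order.TTheory GRing.Theory Num.Theory.

Local Open Scope ring_scope.

(** * Monomials in two variables *)

Definition monom2 (i j : nat) : 'X_{1..2} :=
  (U_(@ord0 1) *+ i + U_(@ord_max 1) *+ j)%MM.

Lemma monom2E (m : 'X_{1..2}) : m = monom2 (m ord0) (m ord_max).
Proof.
apply/mnmP => i; rewrite mnmDE !mulmnE !mnm1E.
by case: i => [[|[|//]] lti] /=; rewrite ?mul1n ?mul0n ?addn0 ?add0n;
   congr (m _); apply: val_inj.
Qed.

Lemma monom2_eq i j k l : (monom2 i j == monom2 k l) = (i == k) && (j == l).
Proof.
apply/eqP/andP => [/mnmP eqm|[/eqP-> /eqP->] //].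
have := eqm ord0; have := eqm ord_max.
by rewrite !mnmDE !mulmnE !mnm1E /= ?mul1n ?mul0n ?addn0 ?add0n => -> ->.
Qed.

Lemma mdeg_monom2 i j : mdeg (monom2 i j) = (i + j)%N.
Proof. by rewrite mdegD !mdegMn !mdeg1 !mul1n. Qed.

(** * Coefficients and values of polynomials of degree at most two *)

Section Quadratic.
Variable R : realType.
Implicit Types P Q : {mpoly R[2]}.

Definition coef2 P i j : R := P@_(monom2 i j).

Lemma mpolyX_monom2 i j : 'X_[monom2 i j] = varx ^+ i * vary ^+ j :> {mpoly R[2]}.
Proof. by rewrite mpolyXD -!mpolyXn. Qed.

Lemma coef2_eq0 P i j : (msize P <= i + j)%N -> coef2 P i j = 0.
Proof.
move=> leP; apply: memN_msupp_eq0; apply: contraL leP => /msize_mdeg_lt.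
by rewrite mdeg_monom2 ltnNge.
Qed.

Lemma quadraticE P : (msize P <= 3)%N ->
  P = (coef2 P 0 0)%:MP + coef2 P 1 0 *: varx + coef2 P 0 1 *: vary
      + coef2 P 2 0 *: varx ^+ 2 + coef2 P 1 1 *: (varx * vary)
      + coef2 P 0 2 *: vary ^+ 2.
Proof.
move=> leP3; apply/mpolyP => m; rewrite (monom2E m).
move: (m ord0) (m ord_max) => i j.
have -> : varx ^+ 2 = 'X_[monom2 2 0] :> {mpoly R[2]} by rewrite mpolyX_monom2 mulr1.
have -> : vary ^+ 2 = 'X_[monom2 0 2] :> {mpoly R[2]} by rewrite mpolyX_monom2 mul1r.
have -> : varx * vary = 'X_[monom2 1 1] :> {mpoly R[2]} by rewrite mpolyX_monom2.
have -> : varx = 'X_[monom2 1 0] :> {mpoly R[2]} by rewrite mpolyX_monom2 mulr1.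
have -> : vary = 'X_[monom2 0 1] :> {mpoly R[2]} by rewrite mpolyX_monom2 mul1r.
have m0 : 0%MM = monom2 0 0 by rewrite [LHS]monom2E !mnm0E.
rewrite !mcoeffD mcoeffC !mcoeffZ !mcoeffX m0 !monom2_eq -/(coef2 P i j).
have [lti|lei] := ltnP (i + j) 3; last first.
  rewrite coef2_eq0 ?(leq_trans leP3) //; move: (coef2 P) => p.
  by case: i j lei => [|[|[|i]]] [|[|[|j]]] // _; rewrite !mulr0 !addr0.
move: (coef2 P) => p.
by case: i j lti => [|[|[|i]]] [|[|[|j]]] // _; rewrite /= ?(mulr0, mulr1, addr0, add0r).
Qed.

Lemma peval_quadratic P x y : (msize P <= 3)%N ->
  peval P x y = coef2 P 0 0 + coef2 P 1 0 * x + coef2 P 0 1 * y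
      + coef2 P 2 0 * x ^+ 2 + coef2 P 1 1 * (x * y) + coef2 P 0 2 * y ^+ 2.
Proof.
move=> /quadraticE {1}->; rewrite /peval !(mevalD, mevalZ, mevalM) mevalC.
by rewrite !mevalXU.
Qed.

(** * Weight vectors as conditions on exponents *)

Lemma quadratic_scaling P A B C i j : (msize P <= 3)%N ->
    (forall x y, peval P (A * x) (B * y) = C * peval P x y) ->
  coef2 P i j * (A ^+ i * B ^+ j) = coef2 P i j * C.
Proof.
move=> leP scaleP; have [lt3|ge3] := ltnP (i + j) 3; last first.
  by rewrite coef2_eq0 ?mul0r // (leq_trans leP).
(* These six points determine a polynomial of degree at most 2, so linear combinations of the
   identities there isolate each coefficient. *)
have := scaleP 0 0; have := scaleP 1 0; have := scaleP (-1) 0.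
have := scaleP 0 1; have := scaleP 0 (-1); have := scaleP 1 1.
rewrite !peval_quadratic //; clear leP scaleP; move: lt3.
move: (coef2 P) => p.
by case: i j => [|[|[|i]]] [|[|[|j]]] // _; lra.
Qed.

(* The shift by one on both sides avoids truncated subtraction. *)
Definition weights (p q : nat -> nat -> R) (s1 s2 d : nat) : Prop :=
  forall i j, (p i j != 0 -> (s1 * i + s2 * j).+1%N = (s1 + d)%N) /\
              (q i j != 0 -> (s1 * i + s2 * j).+1%N = (s2 + d)%N).

Lemma weight_exponent P s1 s2 n i j : (msize P <= 3)%N ->
    (forall alpha x y, 0 < alpha ->
       peval P (alpha ^+ s1 * x) (alpha ^+ s2 * y) = alpha ^+ n * peval P x y) ->
  coef2 P i j != 0 -> (s1 * i + s2 * j)%N = n.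
Proof.
move=> leP scaleP Pij0.
have /(mulfI Pij0) :=
  quadratic_scaling i j leP (fun x y => scaleP 2 x y (ltr0Sn _ _)).
(* The identity now equates two powers of 2, whose exponents must agree. *)
rewrite -!exprM -exprD; apply: ieexprIn; first exact: ltr0Sn.
by apply/eqP; lra.
Qed.

Lemma exponent_weight P s1 s2 n : (msize P <= 3)%N ->
    (forall i j, coef2 P i j != 0 -> (s1 * i + s2 * j)%N = n) ->
  forall alpha x y,
    peval P (alpha ^+ s1 * x) (alpha ^+ s2 * y) = alpha ^+ n * peval P x y.
Proof.
move=> leP expP alpha x y.
rewrite !peval_quadratic //; move: (coef2 P) expP => p expP {leP}.
have term i j : p i j * ((alpha ^+ s1 * x) ^+ i * (alpha ^+ s2 * y) ^+ j)
              = alpha ^+ n * (p i j * (x ^+ i * y ^+ j)).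
  have [->|/expP <-] := eqVneq (p i j) 0; first by rewrite !mul0r mulr0.
  by rewrite exprD !exprM !exprMn; ring.
have := term 0 0; have := term 1 0; have := term 0 1.
have := term 2 0; have := term 1 1; have := term 0 2.
rewrite !expr0 !expr1 !mulr1 !mul1r => e02 e11 e20 e01 e10 e00.
by rewrite !mulrDr e02 e11 e20 e01 e10 {1}e00.
Qed.

Lemma weight_vectorP P Q s1 s2 d : (msize P <= 3)%N -> (msize Q <= 3)%N ->
  weight_vector P Q s1 s2 d <->
  [/\ (0 < s1)%N, (0 < s2)%N, (0 < d)%N & weights (coef2 P) (coef2 Q) s1 s2 d].
Proof.
move=> leP leQ; split=> -[s1_gt0 s2_gt0 d_gt0 w]; split=> //.
  move=> i j; split.
    move/(@weight_exponent _ s1 s2 (s1 + d - 1) i j leP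
           (fun a x y a_gt0 => (w a x y a_gt0).1)); lia.
  move/(@weight_exponent _ s1 s2 (s2 + d - 1) i j leQ
         (fun a x y a_gt0 => (w a x y a_gt0).2)); lia.
move=> alpha x y _; split; apply: exponent_weight => // i j /=;
  have [wP wQ] := w i j; [move/wP | move/wQ]; lia.
Qed.

(** * Classification of the supports *)

Lemma weights_homogeneous P Q s d : (msize P <= 3)%N -> (msize Q <= 3)%N ->
  P != 0 -> (0 < s)%N -> (0 < d)%N -> weights (coef2 P) (coef2 Q) s s d ->
  homogeneous P Q.
Proof.
move=> leP leQ P_neq0 s_gt0 d_gt0 w.
have [m] : exists m, m \in msupp P.
  by exists (mlead P); apply: mlead_supp.
rewrite mcoeff_msupp (monom2E m) => /(proj1 (w _ _)) eqd.
(* With equal weights, [s (i + j) + 1 = s + d] gives all monomials of P and Q the same total degree,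
   which is positive because [d] is. *)
exists (m ord0 + m ord_max)%N; apply/weight_vectorP => //; split=> //; first nia.
by move=> i j; split=> [/(proj1 (w _ _))|/(proj2 (w _ _))] wij; nia.
Qed.

(** An equality rather than an inclusion: the listed coefficients are nonzero, as the conditions on
    the normal forms require. *)
Definition supported (p : nat -> nat -> R) (s : seq (nat * nat)) : Prop :=
  forall i j, (p i j != 0) = ((i, j) \in s).

(* The last two non-vanishing hypotheses say that x, respectively y, is not a
   common factor. *)
Lemma quasi_homogeneous_supports (p q : nat -> nat -> R) s1 s2 d :
    (forall i j, (3 <= i + j)%N -> p i j = 0 /\ q i j = 0) ->
    ~ (forall i j, p i j = 0) -> ~ (forall i j, q i j = 0) ->
    ~ (forall i j, (i + j = 2)%N -> p i j = 0 /\ q i j = 0) ->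
    ~ (forall j, p 0%N j = 0 /\ q 0%N j = 0) ->
    ~ (forall i, p i 0%N = 0 /\ q i 0%N = 0) ->
    weights p q s1 s2 d -> (0 < s2 < s1)%N -> (0 < d)%N ->
  [\/ supported p [:: (1, 0)%N; (0, 2)%N] /\ supported q [:: (0, 1)%N],
      supported p [:: (1, 1)%N] /\ supported q [:: (1, 0)%N; (0, 2)%N]
    | supported p [:: (0, 2)%N] /\ supported q [:: (1, 0)%N]].
Proof.
move=> deg2 p_neq0 q_neq0 deg_eq2 xdiv ydiv w s21 d_gt0.
have pN i j : (s1 * i + s2 * j).+1 != (s1 + d)%N -> p i j = 0.
  by move=> ne; apply: contraNeq ne => /(proj1 (w i j)) ->.
have qN i j : (s1 * i + s2 * j).+1 != (s2 + d)%N -> q i j = 0.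
  by move=> ne; apply: contraNeq ne => /(proj2 (w i j)) ->.
(* These three monomials weigh too little for their lines, because [s1 > s2 > 0] and [d > 0]. *)
have p00 : p 0%N 0%N = 0 by apply: pN; lia.
have p01 : p 0%N 1%N = 0 by apply: pN; lia.
have q00 : q 0%N 0%N = 0 by apply: qN; lia.
(* A term x^2 in P, or x y in Q, forces [d = s1 + 1]; then no power of y lies on either line, and x
   would divide both polynomials. *)
have p20 : p 2%N 0%N = 0.
  apply/eqP; apply: contra_notT xdiv => /(proj1 (w 2%N 0%N)) eqd [|[|[|j]]];
    by split; first [apply: pN; lia | apply: qN; lia | by case: (deg2 0%N j.+3)].
have q11 : q 1%N 1%N = 0.
  apply/eqP; apply: contra_notT xdiv => /(proj2 (w 1%N 1%N)) eqd [|[|[|j]]];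
    by split; first [apply: pN; lia | apply: qN; lia | by case: (deg2 0%N j.+3)].
(* Here [d = 2 s1 + 1 - s2], so the line of P has weight [3 s1 - s2 > 2 s1], beyond every monomial
   of degree at most 2. *)
have q20 : q 2%N 0%N = 0.
  apply/eqP; apply: contra_notT p_neq0 => /(proj2 (w 2%N 0%N)) eqd [|[|[|i]]] [|[|[|j]]];
    first [apply: pN; lia | apply: (deg2 _ _ _).1; lia].
(* Each of the six other coefficients is zero or not. Incompatible weight equations and the five
   exclusion hypotheses remove all but three of the 64 patterns. *)
have [p10|p10] := eqVneq (p 1%N 0%N) 0; have [p11|p11] := eqVneq (p 1%N 1%N) 0;
have [p02|p02] := eqVneq (p 0%N 2%N) 0; have [q10|q10] := eqVneq (q 1%N 0%N) 0;
have [q01|q01] := eqVneq (q 0%N 1%N) 0; have [q02|q02] := eqVneq (q 0%N 2%N) 0.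
all: have := (w 1%N 0%N).1; have := (w 1%N 1%N).1; have := (w 0%N 2%N).1;
  have := (w 1%N 0%N).2; have := (w 0%N 1%N).2; have := (w 0%N 2%N).2.
all: rewrite ?p10 ?p11 ?p02 ?q10 ?q01 ?q02 ?eqxx => e1 e2 e3 e4 e5 e6.
all: try (exfalso; lia).
all: try (case: p_neq0 => -[|[|[|i]]] [|[|[|j]]];
  first [assumption | apply: (deg2 _ _ _).1; lia]).
all: try (case: q_neq0 => -[|[|[|i]]] [|[|[|j]]];
  first [assumption | apply: (deg2 _ _ _).2; lia]).
all: try (case: deg_eq2 => -[|[|[|i]]] [|[|[|j]]] // _; split; assumption).
all: try (case: xdiv => -[|[|[|j]]]; split;
  first [assumption | apply: (deg2 _ _ _).1; lia | apply: (deg2 _ _ _).2; lia]).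
all: try (case: ydiv => -[|[|[|j]]]; split;
  first [assumption | apply: (deg2 _ _ _).1; lia | apply: (deg2 _ _ _).2; lia]).
(* The survivors come in the reverse order of the statement, since vanishing is tried first. *)
all: [> apply: Or33 | apply: Or32 | apply: Or31].
all: split=> -[|[|[|i]]] [|[|[|j]]].
all: first [by rewrite ?(p00, p01, p20, p10, p11, p02, q00, q11, q20, q10, q01,
                         q02, eqxx)
           | by rewrite (deg2 _ _ _).1 ?eqxx | by rewrite (deg2 _ _ _).2 ?eqxx].
Qed.

(** * Exchange of the variables and minimal weights *)

Lemma weights_sym (p q : nat -> nat -> R) s1 s2 d :
  weights p q s1 s2 d ->
  weights (fun i j => q j i) (fun i j => p j i) s2 s1 d.
Proof. by move=> w i j; rewrite addnC; case: (w j i). Qed.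

Lemma supported_eq0 p s i j : supported p s -> (i, j) \notin s -> p i j = 0.
Proof. by move=> sup; rewrite -sup negbK => /eqP. Qed.

(** On an explicit support this computes to linear equations in the weights, shifted by one as in
    [weights]. *)
Definition on_line (s1 s2 n : nat) (s : seq (nat * nat)) : bool :=
  all (fun m => (s1 * m.1 + s2 * m.2).+1 == n) s.

Lemma weights_supported p q sp sq s1 s2 d :
    supported p sp -> supported q sq ->
  weights p q s1 s2 d <-> on_line s1 s2 (s1 + d) sp && on_line s1 s2 (s2 + d) sq.
Proof.
move=> supp supq; split=> [w|/andP[/allP linep /allP lineq] i j]; last first.
  by rewrite supp supq; split=> [/linep|/lineq] /eqP.
apply/andP; split; apply/allP => -[i j].
  by rewrite -supp => /(proj1 (w i j)) /eqP.
by rewrite -supq => /(proj2 (w i j)) /eqP.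
Qed.

(** For explicit supports the weight vectors are the positive solutions of finitely many linear
    equations, so minimality becomes linear arithmetic. *)
Lemma minimal_weight_supported P Q sp sq s1 s2 d :
    (msize P <= 3)%N -> (msize Q <= 3)%N ->
    supported (coef2 P) sp -> supported (coef2 Q) sq ->
    [&& 0 < s1, 0 < s2 & 0 < d]%N ->
    on_line s1 s2 (s1 + d) sp && on_line s1 s2 (s2 + d) sq ->
    (forall r1 r2 e, (0 < r1)%N -> (0 < r2)%N -> (0 < e)%N ->
       on_line r1 r2 (r1 + e) sp && on_line r1 r2 (r2 + e) sq ->
       [/\ s1 <= r1, s2 <= r2 & d <= e]%N) ->
  minimal_weight_vector P Q s1 s2 d.
Proof.
move=> leP leQ supp supq /and3P[s1_gt0 s2_gt0 d_gt0] lines minl; split.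
  by apply/weight_vectorP => //; split=> //; apply/(weights_supported _ _ _ supp supq).
move=> r1 r2 e /(weight_vectorP _ _ _ leP leQ)[r1_gt0 r2_gt0 e_gt0].
by move=> /(weights_supported _ _ _ supp supq); apply: minl.
Qed.

(** * Re-scaling, time derivatives and the change of variables *)

Lemma rescale_poly1 P : rescale_poly 1 1 P = P.
Proof.
rewrite /rescale_poly invr1 !scale1r -[RHS]comp_mpoly_id; congr (_ \mPo _).
apply: eq_from_tnth => -[[|[|//]] lti]; rewrite tnth_mktuple /tnth /=;
  by congr 'X_(_); apply: val_inj.
Qed.

Lemma mderiv_exp (f : {mpoly R[2]}) n i :
  (f ^+ n.+1)^`M(i) = n.+1%:R *: (f ^+ n * f^`M(i)).
Proof.
elim: n => [|n IHn]; first by rewrite expr1 expr0 mul1r scale1r.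
rewrite exprS mderivM IHn -scalerAr mulrA -exprS -[n.+2]add1n natrD scalerDl.
by rewrite scale1r mulrC.
Qed.

Lemma mderiv_var i j : ('X_i : {mpoly R[2]})^`M(j) = (i == j)%:R.
Proof.
rewrite mderivX mnm1E; case: eqP => [->|_]; last by rewrite scale0r.
rewrite scale1r -[RHS]mpolyX0; congr 'X_[_].
by apply/mnmP => k; rewrite mnmBE subnn mnm0E.
Qed.

Lemma peval_time_derivative_varx P Q n x y :
  peval (time_derivative P Q (varx ^+ n.+1)) x y
  = n.+1%:R * x ^+ n * peval P x y.
Proof.
rewrite /time_derivative !mderiv_exp /varx !mderiv_var /= mulr1 mulr0 scaler0.
by rewrite mul0r addr0 /peval mevalM mevalZ rmorphXn /= mevalXU.
Qed.

Lemma peval_time_derivative_vary P Q n x y :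
  peval (time_derivative P Q (vary ^+ n.+1)) x y
  = n.+1%:R * y ^+ n * peval Q x y.
Proof.
rewrite /time_derivative !mderiv_exp /vary !mderiv_var /= mulr1 mulr0 scaler0.
by rewrite mul0r add0r /peval mevalM mevalZ rmorphXn /= mevalXU.
Qed.

(** With all re-scaling constants equal to 1, the chain rule leaves two polynomial identities. Here
    [s1] and [s2] are the weights minus one, the exponents left by differentiation. *)
Lemma transformable_pointwise H P Q Pt Qt s1 s2 d k l :
    minimal_weight_vector P Q s1.+1 s2.+1 d ->
    set_bij H H (fun p : R * R => (p.1 ^+ s2.+1, p.2 ^+ s1.+1)) ->
    (forall x y, s2.+1%:R * x ^+ s2 * peval P x y
                 = x ^+ k * y ^+ l * peval Pt (x ^+ s2.+1) (y ^+ s1.+1)) ->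
    (forall x y, s1.+1%:R * y ^+ s1 * peval Q x y
                 = x ^+ k * y ^+ l * peval Qt (x ^+ s2.+1) (y ^+ s1.+1)) ->
  transformable H P Q Pt Qt.
Proof.
move=> minw bijH eqP eqQ; exists 1, 1, 1; split; rewrite ?oner_eq0 //.
rewrite /rescaleP /rescaleQ !rescale_poly1 divr1 !scale1r /=.
exists s1.+1, s2.+1, d; split=> //; exists k, l => x y _.
by rewrite peval_time_derivative_varx peval_time_derivative_vary.
Qed.

Lemma supported_sym (p : nat -> nat -> R) s :
  supported (fun i j => p j i) s -> supported p [seq (m.2, m.1) | m <- s].
Proof.
move=> sup i j; rewrite (sup j i).
have swap_inj : injective (fun m : nat * nat => (m.2, m.1)).
  by move=> [? ?] [? ?] [-> ->].
by rewrite -(mem_map swap_inj s (j, i)).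
Qed.

(** Filtering a fixed list of all six monomials makes the sum over an explicit support compute to
    its nonzero terms. *)
Lemma peval_supported P s x y : (msize P <= 3)%N -> supported (coef2 P) s ->
  peval P x y = \sum_(m <- [:: (0, 0); (1, 0); (0, 1); (2, 0); (1, 1); (0, 2)]%N
                       | m \in s) coef2 P m.1 m.2 * (x ^+ m.1 * y ^+ m.2).
Proof.
move=> leP sup; rewrite peval_quadratic // big_mkcond.
rewrite (eq_bigr (fun m => coef2 P m.1 m.2 * (x ^+ m.1 * y ^+ m.2))); last first.
  move=> [i j] _; case: ifPn => //= /(supported_eq0 sup) ->; by rewrite mul0r.
rewrite !big_cons big_nil /=; move: (coef2 P) => p; ring.
Qed.

Lemma peval_linear (c d x y : R) : peval (c *: vary + d *: varx) x y = c * y + d * x.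
Proof. by rewrite /peval mevalD !mevalZ !mevalXU. Qed.

Lemma pevalC (c x y : R) : peval c%:MP x y = c.
Proof. exact: mevalC. Qed.

(** * The common factors x and y *)

Lemma varx_dvd P : (msize P <= 3)%N -> (forall j, coef2 P 0 j = 0) ->
  exists A, P = varx * A.
Proof.
move=> leP P0j; exists ((coef2 P 1 0)%:MP + coef2 P 2 0 *: varx + coef2 P 1 1 *: vary).
rewrite [LHS]quadraticE //; move: (coef2 P) P0j => p P0j.
by rewrite !P0j -!mul_mpolyC; ring.
Qed.

Lemma vary_dvd P : (msize P <= 3)%N -> (forall i, coef2 P i 0 = 0) ->
  exists A, P = vary * A.
Proof.
move=> leP Pi0; exists ((coef2 P 0 1)%:MP + coef2 P 1 1 *: varx + coef2 P 0 2 *: vary).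
rewrite [LHS]quadraticE //; move: (coef2 P) Pi0 => p Pi0.
by rewrite !Pi0 -!mul_mpolyC; ring.
Qed.

(** A variable is 0 at the origin and 1 at (1, 1). Hence neither variable divides both polynomials
    of a coprime pair. *)
Lemma var_neqC i (c : R) : 'X_i <> c%:MP :> {mpoly R[2]}.
Proof.
move=> /(congr1 (fun f => (meval (fun=> 0) f, meval (fun=> 1) f))).
rewrite !mevalXU !mevalC => -[<-] /eqP; by rewrite oner_eq0.
Qed.

End Quadratic.

(** * Roots and power maps on the half-planes *)

Section HalfPlanes.
Variable R : realType.

Lemma pos_root n (x : R) : (0 < n)%N -> 0 < x -> exists2 z, 0 < z & z ^+ n = x.
Proof.
move=> n_gt0 x_gt0; have le0 : 0 <= 1 + x by rewrite addr_ge0 ?ltW.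
(* The upper end [1 + x] works: it is at least 1, so its n-th power is at least [1 + x], hence at
   least [x]. *)
have [|z /andP[z_ge0 _]] := @poly_ivt R ('X^n - x%:P) 0 (1 + x) le0.
  rewrite !hornerE expr0n gtn_eqF //= sub0r oppr_le0 ltW //= subr_ge0.
  rewrite (le_trans (_ : x <= 1 + x)) ?lerDr // ler_eXnr // lerDl ltW //.
rewrite rootE !hornerE subr_eq0 => /eqP zn; exists z => //.
rewrite lt_neqAle z_ge0 andbT; apply: contraTneq x_gt0 => z0.
by rewrite -zn -z0 expr0n gtn_eqF // ltxx.
Qed.

Lemma exprNodd n (x : R) : odd n -> (- x) ^+ n = - x ^+ n.
Proof. by move=> n_odd; rewrite exprNn -signr_odd n_odd mulN1r. Qed.

Lemma odd_root n (x : R) : odd n -> exists z, z ^+ n = x.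
Proof.
move=> n_odd; have n_gt0 := odd_gt0 n_odd.
have [x_gt0|x_lt0|<-] := ltrgtP 0 x.
- by have [z _ <-] := pos_root n_gt0 x_gt0; exists z.
- have [|z _ zn] := @pos_root n (- x) n_gt0; first by rewrite oppr_gt0.
  by exists (- z); rewrite exprNodd // zn opprK.
- by exists 0; rewrite expr0n gtn_eqF.
Qed.

(** Odd powers keep the sign, so both arguments are nonnegative or both negative; negation reduces
    the second case to the first. *)
Lemma odd_exprIn n : odd n -> injective (fun x : R => x ^+ n).
Proof.
move=> n_odd x y /= eqxy; have n_gt0 := odd_gt0 n_odd.
have [x_ge0|x_lt0] := lerP 0 x.
  have y_ge0 : 0 <= y by rewrite -(exprn_odd_ge0 _ n_odd) -eqxy exprn_odd_ge0.
  exact: (pexpIrn n_gt0).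
have y_lt0 : y < 0 by rewrite -(exprn_odd_lt0 _ n_odd) -eqxy exprn_odd_lt0.
apply: oppr_inj; apply: (pexpIrn n_gt0); rewrite ?nnegrE ?oppr_ge0 ?ltW //=.
by rewrite !exprNodd // eqxy.
Qed.

(** The first coordinate runs over all reals, where only odd powers are bijective; the second is
    positive, where every positive exponent works. *)
Lemma upper_halfplane_bij m n : odd m -> (0 < n)%N ->
  set_bij (@upper_halfplane R) (@upper_halfplane R) (fun p => (p.1 ^+ m, p.2 ^+ n)).
Proof.
move=> m_odd n_gt0; split.
- by move=> -[x y] /= y_gt0; apply: exprn_gt0.
- move=> -[x1 y1] [x2 y2] /set_mem /= y1_gt0 /set_mem /= y2_gt0 [eqx eqy].
  congr (_, _); first exact: (odd_exprIn m_odd).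
  by apply: (pexpIrn n_gt0); rewrite ?nnegrE ?ltW.
- move=> -[x y] /= y_gt0; have [u um] := odd_root x m_odd.
  by have [v v_gt0 vn] := pos_root n_gt0 y_gt0; exists (u, v) => //=; rewrite um vn.
Qed.

Lemma right_halfplane_bij m n : (0 < m)%N -> odd n ->
  set_bij (@right_halfplane R) (@right_halfplane R) (fun p => (p.1 ^+ m, p.2 ^+ n)).
Proof.
move=> m_gt0 n_odd; split.
- by move=> -[x y] /= x_gt0; apply: exprn_gt0.
- move=> -[x1 y1] [x2 y2] /set_mem /= x1_gt0 /set_mem /= x2_gt0 [eqx eqy].
  congr (_, _); last exact: (odd_exprIn n_odd).
  by apply: (pexpIrn m_gt0); rewrite ?nnegrE ?ltW.
- move=> -[x y] /= x_gt0; have [v vn] := odd_root y n_odd.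
  by have [u u_gt0 um] := pos_root m_gt0 x_gt0; exists (u, v) => //=; rewrite um vn.
Qed.

End HalfPlanes.

(** * The normal forms and their transformations *)

Theorem theorem8 (R : realType) (P Q : {mpoly R[2]})
  (deg_PQ : maxn (msize P) (msize Q) = 3%N) (* msize is the total degree + 1 *)
  (P_neq0 : P != 0) (Q_neq0 : Q != 0)
  (coprime_PQ : no_common_factor P Q)
  (qh_PQ : quasi_homogeneous P Q) (nonhom_PQ : ~ homogeneous P Q) :
  exists H : set (R * R),
    (H = @upper_halfplane R \/ H = @right_halfplane R) /\
    ((exists c01 c10 d01 d10 : R,
        [\/ c01 * d10 != 0,
            d10 = 0 /\ c01 * c10 * d01 != 0
          | c01 = 0 /\ c10 * d01 * d10 != 0] /\
        transformable H P Q (c01 *: vary + c10 *: varx)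
                            (d01 *: vary + d10 *: varx))
     \/
     (exists c0 d0 : R,
        c0 * d0 != 0 /\ transformable H P Q c0%:MP d0%:MP)).
Proof.
have leP : (msize P <= 3)%N by rewrite -deg_PQ leq_maxl.
have leQ : (msize Q <= 3)%N by rewrite -deg_PQ leq_maxr.
have [s1 [s2 [d /(weight_vectorP _ _ _ leP leQ)[s1_gt0 s2_gt0 d_gt0 w]]]] := qh_PQ.
have deg2 i j : (3 <= i + j)%N -> coef2 P i j = 0 /\ coef2 Q i j = 0.
  by move=> ge3; rewrite !coef2_eq0 // (leq_trans _ ge3).
have coef_neq0 (F : {mpoly R[2]}) : F != 0 -> ~ (forall i j, coef2 F i j = 0).
  move=> /eqP F_neq0 F0; apply: F_neq0; apply/mpolyP => m.
  by rewrite mcoeff0 (monom2E m); apply: F0.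
(* Otherwise both polynomials would have degree at most 1. *)
have deg_eq2 : ~ (forall i j, (i + j = 2)%N -> coef2 P i j = 0 /\ coef2 Q i j = 0).
  move=> top0; have: (maxn (msize P) (msize Q) <= 2)%N; last by rewrite deg_PQ.
  have le2 F : (forall i j, (2 <= i + j)%N -> coef2 F i j = 0) -> (msize F <= 2)%N.
    move=> F0; rewrite msizeE; apply/bigmax_leqP_seq => m; rewrite mcoeff_msupp => Fm _.
    rewrite ltnNge; apply: contraNN Fm.
    by rewrite (monom2E m) mdeg_monom2 => /F0 /eqP.
  rewrite geq_max !le2 // => i j; rewrite leq_eqVlt => /predU1P[|/deg2[]//];
    by move/esym/top0=> [].
have xdiv : ~ (forall j, coef2 P 0 j = 0 /\ coef2 Q 0 j = 0).
  move=> x0; have [A PA] := varx_dvd leP (fun j => (x0 j).1).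
  have [B QB] := varx_dvd leQ (fun j => (x0 j).2).
  by have [c /var_neqC] := coprime_PQ _ _ _ PA QB.
have ydiv : ~ (forall i, coef2 P i 0 = 0 /\ coef2 Q i 0 = 0).
  move=> y0; have [A PA] := vary_dvd leP (fun i => (y0 i).1).
  have [B QB] := vary_dvd leQ (fun i => (y0 i).2).
  by have [c /var_neqC] := coprime_PQ _ _ _ PA QB.
have [s21|s12|s12] := ltngtP s2 s1; last first.
- by case: nonhom_PQ; apply: (weights_homogeneous leP leQ P_neq0 s1_gt0 d_gt0); rewrite -{2}s12.
(* For [s1 < s2] the classification is applied with x and y, and also the two equations,
   exchanged. *)
- have [] := quasi_homogeneous_supports _ _ _ _ _ _ (weights_sym w) _ d_gt0.
  + by move=> i j; rewrite addnC => /deg2[].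
  + by move=> Q0; apply: (coef_neq0 _ Q_neq0) => i j; apply: Q0.
  + by move=> P0; apply: (coef_neq0 _ P_neq0) => i j; apply: P0.
  + by move=> top0; apply: deg_eq2 => i j; rewrite addnC => /top0[].
  + by move=> y0; apply: ydiv => j; have [] := y0 j.
  + by move=> x0; apply: xdiv => i; have [] := x0 i.
  + by rewrite s1_gt0.
  (* x' = a x, y' = b y + c x^2. With X = x^2, Y = y: X' = 2a X, Y' = b Y + c X. The even exponent
     is on x, which requires x > 0. *)
  + move=> [/supported_sym supq /supported_sym supp].
    exists (@right_halfplane R); split; [by right|left].
    exists 0, (2 * coef2 P 1 0), (coef2 Q 0 1), (coef2 Q 2 0); split.
      by apply: Or33; rewrite !mulf_neq0 ?supp ?supq ?pnatr_eq0.
    apply: (@transformable_pointwise _ _ _ _ _ _ 0%N 1%N 1%N 0%N 0%N).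
    * apply: (minimal_weight_supported leP leQ supp supq) => // r1 r2 e.
      by rewrite /on_line /= => ? ? ? ?; split; lia.
    * exact: right_halfplane_bij.
    * move=> x y; rewrite (peval_supported _ _ leP supp) !big_cons big_nil /=.
      rewrite peval_linear.
      by move: (coef2 P 1 0) => a; ring.
    * move=> x y; rewrite (peval_supported _ _ leQ supq) !big_cons big_nil /=.
      rewrite peval_linear.
      by move: (coef2 Q 0 1) (coef2 Q 2 0) => b c; ring.
  (* x' = a y + b x^2, y' = c x y. With X = x^2, Y = y: X' = x (2a Y + 2b X), Y' = x (c Y). *)
  + move=> [/supported_sym supq /supported_sym supp].
    exists (@right_halfplane R); split; [by right|left].
    exists (2 * coef2 P 0 1), (2 * coef2 P 2 0), (coef2 Q 1 1), 0; split.
      by apply: Or32; rewrite !mulf_neq0 ?supp ?supq ?pnatr_eq0.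
    apply: (@transformable_pointwise _ _ _ _ _ _ 0%N 1%N 2%N 1%N 0%N).
    * apply: (minimal_weight_supported leP leQ supp supq) => // r1 r2 e.
      by rewrite /on_line /= => ? ? ? ?; split; lia.
    * exact: right_halfplane_bij.
    * move=> x y; rewrite (peval_supported _ _ leP supp) !big_cons big_nil /=.
      rewrite peval_linear.
      by move: (coef2 P 0 1) (coef2 P 2 0) => a b; ring.
    * move=> x y; rewrite (peval_supported _ _ leQ supq) !big_cons big_nil /=.
      rewrite peval_linear.
      by move: (coef2 Q 1 1) => c; ring.
  (* x' = a y, y' = b x^2. With X = x^3, Y = y^2: X' = 3a x^2 y, Y' = 2b x^2 y. The even exponent is
     now on y. *)
  + move=> [/supported_sym supq /supported_sym supp].
    exists (@upper_halfplane R); split; [by left|right].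
    exists (3 * coef2 P 0 1), (2 * coef2 Q 2 0); split.
      by rewrite !mulf_neq0 ?supp ?supq ?pnatr_eq0.
    apply: (@transformable_pointwise _ _ _ _ _ _ 1%N 2%N 2%N 2%N 1%N).
    * apply: (minimal_weight_supported leP leQ supp supq) => // r1 r2 e.
      by rewrite /on_line /= => ? ? ? ?; split; lia.
    * exact: upper_halfplane_bij.
    * move=> x y; rewrite (peval_supported _ _ leP supp) !big_cons big_nil /=.
      rewrite pevalC.
      by move: (coef2 P 0 1) => a; ring.
    * move=> x y; rewrite (peval_supported _ _ leQ supq) !big_cons big_nil /=.
      rewrite pevalC.
      by move: (coef2 Q 2 0) => b; ring.
have s12 : (0 < s2 < s1)%N by rewrite s2_gt0.
have [[supp supq]|[supp supq]|[supp supq]] :=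
  quasi_homogeneous_supports deg2 (coef_neq0 _ P_neq0) (coef_neq0 _ Q_neq0)
    deg_eq2 xdiv ydiv w s12 d_gt0.
(* x' = a y^2 + b x, y' = c y. With X = x, Y = y^2: X' = a Y + b X, Y' = 2c Y. *)
- exists (@upper_halfplane R); split; [by left|left].
  exists (coef2 P 0 2), (coef2 P 1 0), (2 * coef2 Q 0 1), 0; split.
    by apply: Or32; rewrite !mulf_neq0 ?supp ?supq ?pnatr_eq0.
  apply: (@transformable_pointwise _ _ _ _ _ _ 1%N 0%N 1%N 0%N 0%N).
  + apply: (minimal_weight_supported leP leQ supp supq) => // r1 r2 e.
    by rewrite /on_line /= => ? ? ? ?; split; lia.
  + exact: upper_halfplane_bij.
  + move=> x y; rewrite (peval_supported _ _ leP supp) !big_cons big_nil /=.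
    rewrite peval_linear.
    by move: (coef2 P 0 2) (coef2 P 1 0) => a b; ring.
  + move=> x y; rewrite (peval_supported _ _ leQ supq) !big_cons big_nil /=.
    rewrite peval_linear.
    by move: (coef2 Q 0 1) => c; ring.
(* x' = a x y, y' = b y^2 + c x. With X = x, Y = y^2: X' = y (a X), Y' = y (2b Y + 2c X). *)
- exists (@upper_halfplane R); split; [by left|left].
  exists 0, (coef2 P 1 1), (2 * coef2 Q 0 2), (2 * coef2 Q 1 0); split.
    by apply: Or33; rewrite !mulf_neq0 ?supp ?supq ?pnatr_eq0.
  apply: (@transformable_pointwise _ _ _ _ _ _ 1%N 0%N 2%N 0%N 1%N).
  + apply: (minimal_weight_supported leP leQ supp supq) => // r1 r2 e.
    by rewrite /on_line /= => ? ? ? ?; split; lia.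
  + exact: upper_halfplane_bij.
  + move=> x y; rewrite (peval_supported _ _ leP supp) !big_cons big_nil /=.
    rewrite peval_linear.
    by move: (coef2 P 1 1) => a; ring.
  + move=> x y; rewrite (peval_supported _ _ leQ supq) !big_cons big_nil /=.
    rewrite peval_linear.
    by move: (coef2 Q 0 2) (coef2 Q 1 0) => b c; ring.
(* x' = a y^2, y' = b x. With X = x^2, Y = y^3: X' = 2a x y^2, Y' = 3b x y^2. *)
- exists (@right_halfplane R); split; [by right|right].
  exists (2 * coef2 P 0 2), (3 * coef2 Q 1 0); split.
    by rewrite !mulf_neq0 ?supp ?supq ?pnatr_eq0.
  apply: (@transformable_pointwise _ _ _ _ _ _ 2%N 1%N 2%N 1%N 2%N).
  + apply: (minimal_weight_supported leP leQ supp supq) => // r1 r2 e.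
    by rewrite /on_line /= => ? ? ? ?; split; lia.
  + exact: right_halfplane_bij.
  + move=> x y; rewrite (peval_supported _ _ leP supp) !big_cons big_nil /=.
    rewrite pevalC.
    by move: (coef2 P 0 2) => a; ring.
  + move=> x y; rewrite (peval_supported _ _ leQ supq) !big_cons big_nil /=.
    rewrite pevalC.
    by move: (coef2 Q 1 0) => b; ring.
Qed.
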